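(* Let $A$ and $B$ be Banach algebras such that $B$ is a Banach $A$-bimodule. Let $T:A\to B$ be a continuous (bounded linear) algebra homomorphism. If $T$ is weakly compact, then the bilinear mapping $m:A\times A\to B$ defined by $m(a_1,a_2)=T(a_1a_2)$ is Arens regular.
   Context: For normed spaces $X,Y,Z$ and a bounded bilinear map $m:X\times Y\to Z$, define $m^*:Z^*\times X\to Y^*$ by $\langle m^*(z',x),y\rangle=\langle z',m(x,y)\rangle$; $m^{**}:Y^{**}\times Z^*\to X^*$ by $\langle m^{**}(y'',z'),x\rangle=\langle y'',m^*(z',x)\rangle$; $m^{***}:X^{**}\times Y^{**}\to Z^{**}$ by $\langle m^{***}(x'',y''),z'\rangle=\langle x'',m^{**}(y'',z')\rangle$. Let $m^t(y,x)=m(x,y)$ be the transpose of $m$; applying the construction to $m^t$ gives $m^{t***}:Y^{**}\times X^{**}\to Z^{**}$, whose transpose is $m^{t***t}:X^{**}\times Y^{**}\to Z^{**}$. The map $m$ is Arens regular if $m^{***}=m^{t***t}$. *)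

(* Defs.v *)
From HB Require Import structures.
From mathcomp Require Import all_boot all_order all_algebra.
From mathcomp Require Import sesquilinear complex.
From mathcomp Require Import all_classical all_reals all_analysis.

Set Implicit Arguments.
Unset Strict Implicit.
Unset Printing Implicit Defensive.

Import Order.TTheory GRing.Theory Num.Theory.
Import numFieldNormedType.Exports.

Local Open Scope classical_set_scope.
Local Open Scope ring_scope.

(* All spaces are over the reals or over the complex numbers; the definitions
   are uniform in the choice.  The norm of a normedModType K takes its values
   in K, so suprema are computed in R and embedded back. *)
Variant scalars := RealScalars | ComplexScalars.

Definition scalar_field (R : realType) (k : scalars) : numFieldType :=
  match k with RealScalars => R | ComplexScalars => R[i] end.

Definition scalar_of_real (R : realType) (k : scalars) :
    R -> scalar_field R k :=
  match k with
  | RealScalars => fun r => r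
  | ComplexScalars => fun r => (r%:C)%C
  end.

Definition scalar_abs (R : realType) (k : scalars) : scalar_field R k -> R :=
  match k with
  | RealScalars => fun z => `|z|
  | ComplexScalars => fun z => complex.Re `|z|
  end.

Section scalar_theory.
Context {R : realType} {k : scalars}.
Local Notation K := (scalar_field R k).
Implicit Types (z w : K) (r s : R).

Lemma scalar_of_realD r s :
  scalar_of_real k (r + s) = scalar_of_real k r + scalar_of_real k s.
Proof. by case: k => //=; rewrite rmorphD. Qed.

Lemma scalar_of_realM r s :
  scalar_of_real k (r * s) = scalar_of_real k r * scalar_of_real k s.
Proof. by case: k => //=; rewrite rmorphM. Qed.

Lemma scalar_of_real0 : scalar_of_real k 0 = 0 :> K.
Proof. by case: k. Qed.

Lemma scalar_of_real_le r s :
  (scalar_of_real k r <= scalar_of_real k s) = (r <= s).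
Proof. by case: k => //=; rewrite lecR. Qed.

Lemma scalar_absK z : scalar_of_real k (scalar_abs z) = `|z|.
Proof.
by case: k z => //= z; rewrite RRe_real// realE normr_ge0.
Qed.

Lemma scalar_abs_ge0 z : 0 <= scalar_abs z.
Proof. by rewrite -(scalar_of_real_le) scalar_absK scalar_of_real0. Qed.

Lemma scalar_abs_le z w : (scalar_abs z <= scalar_abs w) = (`|z| <= `|w|).
Proof. by rewrite -scalar_of_real_le !scalar_absK. Qed.

Lemma scalar_absM z w : scalar_abs (z * w) = scalar_abs z * scalar_abs w.
Proof.
apply/eqP; rewrite eq_le -!scalar_of_real_le scalar_of_realM !scalar_absK.
by rewrite normrM lexx.
Qed.

Lemma scalar_absD z w : scalar_abs (z + w) <= scalar_abs z + scalar_abs w.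
Proof. by rewrite -scalar_of_real_le scalar_of_realD !scalar_absK ler_normD. Qed.

End scalar_theory.

Section dual.
Context {R : realType} {k : scalars}.
Local Notation K := (scalar_field R k).
Variable X : normedModType K.

Definition continuous_functional : {pred X -> K^o} :=
  mem [set f : X -> K^o | linear f /\ continuous f].

Record dual : Type := Dual {
  dual_fun : X -> K^o ;
  _ : dual_fun \in continuous_functional }.

HB.instance Definition _ := [isSub for dual_fun].
HB.instance Definition _ := [Choice of dual by <:].

Lemma continuous_functional_submod_closed : submod_closed continuous_functional.
Proof.
split.
  rewrite inE; split; last by move=> x; exact: cvg_cst.
  by move=> a x y; rewrite scaler0 addr0.
move=> a f g; rewrite !inE => -[lf cf] [lg cg]; split.
  move=> b x y; rewrite /= !fctE lf lg !scalerDr !scalerA [b * a]mulrC.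
  by rewrite !addrA; congr (_ + _); rewrite -!addrA; congr (_ + _); rewrite addrC.
move=> x; apply: cvgD; last exact: cg.
by apply: cvgZl_tmp; exact: cf.
Qed.

HB.instance Definition _ := GRing.isSubmodClosed.Build K (X -> K^o)
  continuous_functional continuous_functional_submod_closed.
HB.instance Definition _ := [SubChoice_isSubLmodule of dual by <:].

Coercion dual_fun : dual >-> Funclass.

Lemma dual_linear (f : dual) : linear f.
Proof. by case: f => f /= /[!inE] -[]. Qed.

Lemma dual_continuous (f : dual) : continuous f.
Proof. by case: f => f /= /[!inE] -[]. Qed.

HB.instance Definition _ (f : dual) :=
  GRing.isLinear.Build K X K^o _ (dual_fun f) (dual_linear f).

Definition dual_norm (f : dual) : K :=
  scalar_of_real k (sup [set scalar_abs (f x) | x in [set x | `|x| <= 1]]).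


Lemma dual_bounded (f : dual) :
  exists2 M : K, 0 < M & forall x, `|f x| <= M * `|x|.
Proof.
have /linear_boundedP/pinfty_ex_gt0[M M0 fM] : bounded_near f (nbhs (0 : X)).
  by apply: continuous_linear_bounded; exact: dual_continuous.
by exists M.
Qed.

Lemma dual_norm_has_sup (f : dual) :
  has_sup [set scalar_abs (f x) | x in [set x | `|x| <= 1]].
Proof.
split; first by exists (scalar_abs (f 0)), 0 => //=; rewrite normr0 ler01.
have [M M0 fM] := dual_bounded f.
exists (scalar_abs M) => _ [x /= x1 <-]; rewrite scalar_abs_le (gtr0_norm M0).
by apply: le_trans (fM x) _; rewrite ler_piMr// ltW.
Qed.

Lemma dual_norm_ub (f : dual) x : `|f x| <= dual_norm f * `|x|.
Proof.
have [->|x0] := eqVneq x 0; first by rewrite linear0 !normr0 mulr0.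
have nx0 : 0 < `|x| by rewrite normr_gt0.
have -> : x = `|x| *: (`|x|^-1 *: x) by rewrite scalerA divff ?scale1r// gt_eqF.
rewrite linearZ /= [in leRHS]scalerA divff ?gt_eqF// scale1r.
rewrite -[_ *: _ in leLHS]/(_ * _) normrM normr_id mulrC ler_pM2r//.
rewrite -scalar_absK scalar_of_real_le; apply: ub_le_sup.
  by have [] := dual_norm_has_sup f.
by exists (`|x|^-1 *: x) => //=; rewrite normrZ normfV normr_id mulVf// gt_eqF.
Qed.

Lemma dual_norm_le (f : dual) (M : K) :
  0 <= M -> (forall x, `|f x| <= M * `|x|) -> dual_norm f <= M.
Proof.
move=> M0 fM; rewrite -(ger0_norm M0) -scalar_absK scalar_of_real_le.
apply: ge_sup; first by have [] := dual_norm_has_sup f.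
move=> _ [x /= x1 <-]; rewrite scalar_abs_le (ger0_norm M0).
by apply: le_trans (fM x) _; rewrite ler_piMr.
Qed.

Lemma dual_norm_ge0 (f : dual) : 0 <= dual_norm f.
Proof.
rewrite /dual_norm -[leLHS](scalar_of_real0 (k := k)) scalar_of_real_le.
rewrite (le_trans (scalar_abs_ge0 (f 0)))//; apply: ub_le_sup.
  by have [] := dual_norm_has_sup f.
by exists 0 => //=; rewrite normr0 ler01.
Qed.

Lemma dual_addE (f g : dual) x : (f + g) x = f x + g x. Proof. by []. Qed.
Lemma dual_scaleE (a : K) (f : dual) x : (a *: f) x = a *: f x. Proof. by []. Qed.

Lemma dual_ext (f g : dual) : (forall x, f x = g x) -> f = g.
Proof. by move=> fg; apply/val_inj/funext. Qed.

Lemma dual_normD (f g : dual) : dual_norm (f + g) <= dual_norm f + dual_norm g.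
Proof.
apply: dual_norm_le; first by rewrite addr_ge0// dual_norm_ge0.
move=> x; rewrite dual_addE mulrDl (le_trans (ler_normD _ _))//.
by rewrite lerD// dual_norm_ub.
Qed.

Lemma dual_normZ (a : K) (f : dual) : dual_norm (a *: f) = `|a| * dual_norm f.
Proof.
have le_normZ (b : K) (g : dual) : dual_norm (b *: g) <= `|b| * dual_norm g.
  apply: dual_norm_le; first by rewrite mulr_ge0// dual_norm_ge0.
  by move=> x; rewrite dual_scaleE normrZ -mulrA ler_wpM2l// dual_norm_ub.
apply/eqP; rewrite eq_le le_normZ /=.
have [->|a0] := eqVneq a 0; first by rewrite normr0 mul0r dual_norm_ge0.
rewrite -ler_pdivlMl ?normr_gt0// -normfV.
by rewrite -{1}(scale1r f) -(mulVf a0) -scalerA le_normZ.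
Qed.

Lemma dual_norm0_eq0 (f : dual) : dual_norm f = 0 -> f = 0.
Proof.
move=> f0; apply: dual_ext => x; apply/eqP; rewrite -normr_le0.
by apply: le_trans (dual_norm_ub f x) _; rewrite f0 mul0r.
Qed.

HB.instance Definition _ := Lmodule_isNormed.Build K dual
  dual_normD dual_normZ dual_norm0_eq0.

Lemma continuous_functionalP (f : X -> K^o) (M : K) : linear f ->
  (forall x, `|f x| <= M * `|x|) -> f \in continuous_functional.
Proof.
move=> lf fM; rewrite inE; split=> //.
pose fl := GRing.isLinear.Build K X K^o _ f lf.
pose F : {linear X -> K^o} := HB.pack f fl.
apply: (@bounded_linear_continuous _ _ _ F); apply/linear_boundedP.
have {}fM x : `|f x| <= `|M| * `|x|.
  apply: le_trans (fM x) _; rewrite -[in leRHS]normr_id -normrM.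
  by rewrite ger0_norm//; exact: le_trans (fM x).
near=> r => x; apply: le_trans (fM x) _; rewrite ler_wpM2r//.
Unshelve. all: by end_near. Qed.

End dual.

Arguments continuous_functional {R k X}.

Section bounded_bilinear.
Context {R : realType} {k : scalars}.
Local Notation K := (scalar_field R k).

Record bounded_bilinear (X Y Z : normedModType K) := BoundedBilinear {
  bilin_fun :> {bilinear X -> Y -> Z} ;
  bilin_bounded : exists M : K, forall x y,
    `|bilin_fun x y| <= M * `|x| * `|y| }.

Definition mk_bounded_bilinear (X Y Z : normedModType K) (f : X -> Y -> Z)
    (lf : bilinear_for *:%R *:%R f)
    (bf : exists M : K, forall x y, `|f x y| <= M * `|x| * `|y|) :
    bounded_bilinear X Y Z :=
  @BoundedBilinear X Y Z
    (HB.pack_for {bilinear X -> Y -> Z} f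
       (bilinear_isBilinear.Build K X Y Z *:%R *:%R f lf)) bf.

(* m^t *)
Section transpose.
Context {X Y Z : normedModType K} (m : bounded_bilinear X Y Z).

Let transpose_fun (y : Y) (x : X) : Z := m x y.

Let transpose_bilinear : bilinear_for *:%R *:%R transpose_fun.
Proof.
by split=> [x|y] a u v; rewrite /transpose_fun/= ?(linearPl, linearPr).
Qed.

Let transpose_bounded :
  exists M : K, forall y x, `|transpose_fun y x| <= M * `|y| * `|x|.
Proof.
by have [M mM] := bilin_bounded m; exists M => y x; rewrite mulrAC; exact: mM.
Qed.

Definition transpose : bounded_bilinear Y X Z :=
  mk_bounded_bilinear transpose_bilinear transpose_bounded.

End transpose.

(* m^*, see adjointE *)
Section adjoint.
Context {X Y Z : normedModType K} (m : bounded_bilinear X Y Z).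

Let adjoint_val (z' : dual Z) (x : X) (y : Y) : K^o := z' (m x y).

Let adjoint_val_bounded : exists2 M : K, 0 <= M &
  forall z' x y, `|adjoint_val z' x y| <= M * `|z'| * `|x| * `|y|.
Proof.
have [M mM] := bilin_bounded m; exists `|M| => // z' x y.
apply: le_trans (dual_norm_ub z' _) _.
rewrite [`|M| * _]mulrC -!mulrA ler_wpM2l ?dual_norm_ge0//.
rewrite -[X in _ * X]ger0_norm ?mulr_ge0// -normrM mulrA ger0_norm//.
exact: le_trans (mM x y).
Qed.

Let adjoint_val_in z' x : adjoint_val z' x \in continuous_functional.
Proof.
have [M M0 aM] := adjoint_val_bounded.
apply: (@continuous_functionalP _ _ _ _ (M * `|z'| * `|x|)) => //.
by move=> a u v; rewrite /adjoint_val linearPr linearP.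
Qed.

Let adjoint_fun (z' : dual Z) (x : X) : dual Y := Dual (adjoint_val_in z' x).

Let adjoint_bilinear : bilinear_for *:%R *:%R adjoint_fun.
Proof.
split=> [x|z'] a u v; apply: dual_ext => y.
  by rewrite dual_addE dual_scaleE.
by rewrite dual_addE dual_scaleE /= /adjoint_val linearPl linearP.
Qed.

Let adjoint_bounded :
  exists M : K, forall z' x, `|adjoint_fun z' x| <= M * `|z'| * `|x|.
Proof.
have [M M0 aM] := adjoint_val_bounded; exists M => z' x.
by apply: dual_norm_le => [|y]; [rewrite !mulr_ge0|exact: aM].
Qed.

Definition adjoint : bounded_bilinear (dual Z) X (dual Y) :=
  mk_bounded_bilinear adjoint_bilinear adjoint_bounded.

Lemma adjointE z' x y : adjoint z' x y = z' (m x y).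
Proof. by []. Qed.

End adjoint.

(* m^***; arens_regular below compares it with m^{t***t} *)
Definition triple_adjoint (X Y Z : normedModType K)
    (m : bounded_bilinear X Y Z) :
    bounded_bilinear (dual (dual X)) (dual (dual Y)) (dual (dual Z)) :=
  adjoint (adjoint (adjoint m)).

Definition arens_regular (X Y Z : normedModType K)
    (m : bounded_bilinear X Y Z) : Prop :=
  forall (x'' : dual (dual X)) (y'' : dual (dual Y)),
    triple_adjoint m x'' y'' = transpose (triple_adjoint (transpose m)) x'' y''.

End bounded_bilinear.

(* Banach algebras need not be unital, so they are not built on MathComp's
   ring structures. *)
HB.mixin Record isBanachAlgebra (K : numFieldType) A
    & CompleteNormedModule K A := {
  bmul : A -> A -> A ;
  bmulA : associative bmul ;
  bmul_bilinear : bilinear_for *:%R *:%R bmul ;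
  bmul_norm : forall x y, `|bmul x y| <= `|x| * `|y| }.

#[short(type="banachAlgType")]
HB.structure Definition BanachAlgebra (K : numFieldType) :=
  {A of CompleteNormedModule K A & isBanachAlgebra K A}.

Section banach_algebra_maps.
Context {R : realType} {k : scalars}.
Local Notation K := (scalar_field R k).

(* The actions are only required to be bounded, not contractive. *)
Record banach_bimodule (A : banachAlgType K) (B : completeNormedModType K) :=
  BanachBimodule {
    lact : bounded_bilinear A B B ;
    ract : bounded_bilinear B A B ;
    lact_mul : forall a1 a2 b, lact (bmul a1 a2) b = lact a1 (lact a2 b) ;
    ract_mul : forall a1 a2 b, ract b (bmul a1 a2) = ract (ract b a1) a2 ;
    lact_ract : forall a1 a2 b, ract (lact a1 b) a2 = lact a1 (ract b a2) }.

(* X with the topology sigma(X, X'), i.e. the coarsest topology for which all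
   the continuous functionals are continuous. *)
Definition weak_space (X : normedModType K) : Type :=
  initial_topology (fun (x : X) => (fun f => f x) : {ptws dual X -> K^o}).

HB.instance Definition _ (X : normedModType K) :=
  Topological.on (weak_space X).

Definition weakly_compact (X Y : normedModType K) (T : X -> Y) : Prop :=
  precompact (T @` [set x | `|x| <= 1] : set (weak_space Y)).

Section hom_mul.
Context {A B : banachAlgType K} (T : {linear A -> B}) (cT : continuous T).

Let hom_mul_fun (a1 a2 : A) : B := T (bmul a1 a2).

Let hom_mul_bilinear : bilinear_for *:%R *:%R hom_mul_fun.
Proof.
split=> [y|x] a u v.
  by rewrite /hom_mul_fun /= bmul_bilinear.1 linearP.
by rewrite /hom_mul_fun /= bmul_bilinear.2 linearP.
Qed.

Let hom_mul_bounded :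
  exists M : K, forall a1 a2, `|hom_mul_fun a1 a2| <= M * `|a1| * `|a2|.
Proof.
have /linear_boundedP/pinfty_ex_gt0[M M0 TM] : bounded_near T (nbhs (0 : A)).
  by apply: continuous_linear_bounded; exact: cT.
exists M => a1 a2; apply: le_trans (TM _) _.
by rewrite -mulrA ler_pM2l// bmul_norm.
Qed.

Definition hom_mul : bounded_bilinear A A B :=
  mk_bounded_bilinear hom_mul_bilinear hom_mul_bounded.

Lemma hom_mulE a1 a2 : hom_mul a1 a2 = T (bmul a1 a2).
Proof. by []. Qed.

End hom_mul.

End banach_algebra_maps.

(* Main.v *)
Require Import Defs.
From HB Require Import structures.
From mathcomp Require Import all_boot all_order all_algebra.
From mathcomp Require Import all_classical all_reals all_analysis.
From mathcomp Require Import complex ring lra.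

Import numFieldNormedType.Exports.
Local Open Scope classical_set_scope.
Local Open Scope ring_scope.
Import Order.TTheory GRing.Theory Num.Theory.

(** The multiplication of A enters only through T (a1 a2) = T a1 * T a2, so
    that m(a1, a2) = n(T a1, a2) with n : B x A -> B, n(b, a) = b * T a.  By
    Gantmacher's theorem the bidual map of a weakly compact T takes its values
    in the canonical image of B: given x'' there is b in B with
    x''(f o T) = f(b) for every f in the dual of B
    ([weakly_compact_bidual]).  Both Arens extensions are iterated limits in
    which x'' is applied to functionals of the form f o T only, and replacing
    these values by f(b) turns either of them into
    y''(y |-> z'(n(b, y))); this is [arens_regular_comp_weakly_compact].

    Gantmacher's theorem rests on Goldstine's: a bidual element of norm at
    most 1 is a weak-star limit of points of the unit ball
    ([bidual_approx]).  Instead of a Hahn-Banach separation, the proof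
    minimises the sum of the |f x - x''(f)|^2 over the unit ball for finitely
    many f, and uses the first-order condition at a near-minimiser to produce
    a functional that separates x'' from the ball if the infimum is
    positive. *)

Set Implicit Arguments.
Unset Strict Implicit.
Unset Printing Implicit Defensive.

(** * Real parts and conjugates, uniformly in the scalar field *)

Definition scalar_re (R : realType) (k : scalars) : scalar_field R k -> R :=
  match k with
  | RealScalars => fun z => z
  | ComplexScalars => fun z => complex.Re z
  end.

Definition scalar_conj (R : realType) (k : scalars) :
    scalar_field R k -> scalar_field R k :=
  match k with
  | RealScalars => fun z => z
  | ComplexScalars => fun z => conjc z
  end.

Section scalars.
Context {R : realType} {k : scalars}.
Local Notation K := (scalar_field R k).
Implicit Types (z w : K) (r : R).

Lemma scalar_reD z w : scalar_re (z + w) = scalar_re z + scalar_re w.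
Proof. by case: k z w => //= -[a b] [c d]. Qed.

Lemma scalar_reN z : scalar_re (- z) = - scalar_re z.
Proof. by case: k z => //= -[a b]. Qed.

Lemma scalar_re_sum (I : Type) (s : seq I) (F : I -> K) :
  scalar_re (\sum_(i <- s) F i) = \sum_(i <- s) scalar_re (F i).
Proof.
elim: s => [|i s ih]; last by rewrite !big_cons scalar_reD ih.
by rewrite !big_nil; case: (k).
Qed.

Lemma scalar_re_of_real r : scalar_re (scalar_of_real k r) = r.
Proof. by case: k. Qed.

Lemma scalar_re0 : scalar_re (0 : K) = 0.
Proof. by rewrite -scalar_of_real0 scalar_re_of_real. Qed.

Lemma scalar_abs0 : scalar_abs (0 : K) = 0.
Proof.
by rewrite -(scalar_re_of_real (scalar_abs _)) scalar_absK normr0 scalar_re0.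
Qed.

Lemma scalar_absN z : scalar_abs (- z) = scalar_abs z.
Proof. by apply/eqP; rewrite eq_le !scalar_abs_le normrN lexx. Qed.

Lemma scalar_abs_sqr z : scalar_abs z ^+ 2 = scalar_re (scalar_conj z * z).
Proof.
case: k z => /= [z|[a b]]; first by rewrite real_normK ?num_real.
transitivity (complex.Re `|(a +i* b)%C : R[i]| ^+ 2); first by [].
by rewrite normc_def /= sqr_sqrtr ?addr_ge0 ?sqr_ge0//; ring.
Qed.

Lemma scalar_re_le_abs z : scalar_re z <= scalar_abs z.
Proof.
case: k z => /= [z|z]; first exact: ler_norm.
apply: le_trans (ler_norm _) _.
rewrite -lecR; apply: le_trans (normc_ge_Re z) _.
by have := scalar_absK (k := ComplexScalars) z => /= ->.
Qed.

(** The expansion of a squared distance along a segment, on which the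
    variational argument of [bidual_approx] runs. *)
Lemma scalar_abs_sqrD z w r :
  scalar_abs (z + scalar_of_real k r * w) ^+ 2 =
  scalar_abs z ^+ 2 + r * (scalar_re (scalar_conj z * w) *+ 2)
  + r ^+ 2 * scalar_abs w ^+ 2.
Proof.
rewrite !scalar_abs_sqr.
by case: k z w => /= [z w|[a b] [c d]]/=; ring.
Qed.

Lemma normr_scalar_of_real r : `|scalar_of_real k r| = scalar_of_real k `|r|.
Proof.
case: k => //=.
transitivity `|(r%:C)%C : R[i]|; first by [].
by rewrite normc_def /= expr0n/= addr0 sqrtr_sqr.
Qed.

End scalars.

(** * Approximation of bidual elements by points of the unit ball *)

Section dual_lemmas.
Context {R : realType} {k : scalars}.
Local Notation K := (scalar_field R k).
Variable X : normedModType K.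

Lemma dual_sumE (I : Type) (s : seq I) (c : I -> K) (f : I -> dual X) x :
  (\sum_(i <- s) c i *: f i) x = \sum_(i <- s) c i * f i x.
Proof. by elim: s => [|i s ih]; rewrite ?big_nil// !big_cons -ih. Qed.

(** The unit ball is stable under scalars of modulus 1, so f x may be rotated
    onto the nonnegative half-line. *)
Lemma dual_norm_le_re (f : dual X) (L : R) :
  (forall x, `|x| <= 1 -> scalar_re (f x) <= L) -> `|f| <= scalar_of_real k L.
Proof.
move=> fL; rewrite scalar_of_real_le; apply: ge_sup.
  by have [] := dual_norm_has_sup f.
move=> _ [x /= x1 <-].
have [fx0|fx0] := eqVneq (f x) 0.
  apply: le_trans (fL 0 _); last by rewrite normr0 ler01.
  by rewrite fx0 linear0 scalar_re0 scalar_abs0.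
have u1 : `| `|f x| / f x | = 1 by rewrite normf_div normr_id divff// normr_eq0.
have := fL (`|f x| / f x *: x).
rewrite normrZ u1 mul1r => /(_ x1); rewrite linearZ/=.
by rewrite -[X in scalar_re X]/(_ * _) divfK// -scalar_absK scalar_re_of_real.
Qed.

(** Goldstine's theorem.  Let q x be the sum of |f x - x''(f)|^2 over s, and
    suppose that its infimum d on the unit ball is positive.  At a
    near-minimiser y put v f = f y - x''(f).  Moving from y towards a point t
    of the ball cannot decrease q much, which bounds the real part of F t by
    that of F y plus d / 2, where F is minus the sum of the conj(v f) f.  Hence
    |x''(F)| <= ||F|| <= Re (F y) + d / 2, whereas the choice of F makes
    Re x''(F) - Re (F y) equal to q y >= d. *)
Lemma bidual_approx (x'' : dual (dual X)) (s : seq (dual X)) (e : R) :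
  `|x''| <= 1 -> 0 < e ->
  exists2 x, `|x| <= 1 & forall f, f \in s -> scalar_abs (f x - x'' f) < e.
Proof.
move=> x1 e0.
pose q x := \sum_(f <- s) scalar_abs (f x - x'' f) ^+ 2.
have q0 x : 0 <= q x by apply: sumr_ge0 => f _; rewrite sqr_ge0.
suff [x x1' qx] : exists2 x, `|x| <= 1 & q x < e ^+ 2.
  exists x => // f fs; rewrite -(@ltr_pXn2r _ 2)// ?nnegrE ?scalar_abs_ge0 ?ltW//.
  apply: le_lt_trans qx; rewrite /q (big_rem f)//= lerDl.
  by apply: sumr_ge0 => g _; rewrite sqr_ge0.
apply: contrapT => /forall2NP qe.
have {}qe x : `|x| <= 1 -> e ^+ 2 <= q x.
  by move=> xle; case: (qe x) => // /negP; rewrite -leNgt.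
pose Q := [set q x | x in [set x : X | `|x| <= 1]].
have infQ : has_inf Q.
  split; first by exists (q 0), 0 => //=; rewrite normr0 ler01.
  by exists 0 => _ [x _ <-].
pose d := inf Q.
have d0 : 0 < d.
  apply: lt_le_trans (exprn_gt0 2 e0) _; apply: lb_le_inf infQ.1 _.
  by move=> _ [x /= + <-]; exact: qe.
have dq x : `|x| <= 1 -> d <= q x by move=> xle; apply: ge_inf infQ.2 _ _; exists x.
pose C := \sum_(f <- s) (scalar_abs `|f| *+ 2) ^+ 2.
have C0 : 0 <= C by apply: sumr_ge0 => f _; rewrite sqr_ge0.
(* The step l and the error l ^+ 2 in the choice of y are balanced so that the
   two error terms of the first-order condition, l and l * C after division by
   l, add up to at most d. *)
pose l := Num.min 1 (d / (1 + C)).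
have C1 : 0 < 1 + C by lra.
have l0 : 0 < l by rewrite lt_min ltr01 divr_gt0.
have l1 : l <= 1 by rewrite ge_min lexx.
have lC : l * (1 + C) <= d.
  by rewrite -ler_pdivlMr// ge_min lexx orbT.
have [_ [y /= y1 <-] qy] := inf_adherent (exprn_gt0 2 l0) infQ.
rewrite -/d in qy.
pose v (f : dual X) := f y - x'' f.
(* First-order condition at y in the direction t - y. *)
have var t : `|t| <= 1 ->
    - (\sum_(f <- s) scalar_re (scalar_conj (v f) * (f t - f y)) *+ 2) <= d.
  move=> t1; set S := \sum_(f <- s) _.
  pose W := \sum_(f <- s) scalar_abs (f t - f y) ^+ 2.
  have WC : W <= C.
    apply: ler_sum => f _; rewrite lerXn2r ?nnegrE ?mulrn_wge0 ?scalar_abs_ge0//.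
    have fle z : `|z| <= 1 -> scalar_abs (f z) <= scalar_abs `|f|.
      move=> z1; rewrite scalar_abs_le normr_id.
      by apply: le_trans (dual_norm_ub f z) _; rewrite ler_piMr ?dual_norm_ge0.
    by rewrite (le_trans (scalar_absD _ _))// scalar_absN mulr2n lerD// fle.
  pose z := y + scalar_of_real k l *: (t - y).
  have z1 : `|z| <= 1.
    have -> : z = scalar_of_real k (1 - l) *: y + scalar_of_real k l *: t.
      rewrite /z scalerBr addrCA addrC; congr (_ + _).
      have -> : scalar_of_real k (1 - l) = 1 - scalar_of_real k l.
        by case: (k) => //=; rewrite rmorphB.
      by rewrite scalerBl scale1r.
    rewrite (le_trans (ler_normD _ _))// !normrZ !normr_scalar_of_real.
    rewrite (ger0_norm (ltW l0)) (@ger0_norm _ (1 - l)) ?subr_ge0//.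
    have ge0 r : 0 <= r -> 0 <= scalar_of_real k r.
      by rewrite -(scalar_of_real_le (k := k)) scalar_of_real0.
    apply: (@le_trans _ _ (scalar_of_real k (1 - l) * 1 + scalar_of_real k l * 1)).
      by rewrite lerD// ler_wpM2l// ge0 ?subr_ge0// ltW.
    by rewrite !mulr1 -scalar_of_realD subrK; case: (k).
  have qz : q z = q y + l * S + l ^+ 2 * W.
    rewrite /q /S /W !mulr_sumr -!big_split/=; apply: eq_bigr => f _.
    rewrite -scalar_abs_sqrD; congr (scalar_abs _ ^+ 2).
    rewrite /z linearD linearZ/= linearB -[_ *: _]/(_ * _) /v.
    by rewrite addrAC.
  have := dq _ z1; rewrite qz => dz.
  have : l * (- S) <= l * d.
    apply: le_trans (_ : l * (l * (1 + C)) <= _); last by rewrite ler_pM2l.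
    have : l ^+ 2 * W <= l ^+ 2 * C by rewrite ler_pM2l// exprn_gt0.
    nra.
  by rewrite ler_pM2l.
pose F : dual X := \sum_(f <- s) - scalar_conj (v f) *: f.
have FE x : scalar_re (F x) = - \sum_(f <- s) scalar_re (scalar_conj (v f) * f x).
  rewrite dual_sumE scalar_re_sum -sumrN; apply: eq_bigr => f _.
  by rewrite mulNr scalar_reN.
have xFE : scalar_re (x'' F) =
    - \sum_(f <- s) scalar_re (scalar_conj (v f) * x'' f).
  rewrite linear_sum scalar_re_sum -sumrN; apply: eq_bigr => f _.
  by rewrite linearZ/= -[X in scalar_re X]/(_ * _) mulNr scalar_reN.
have FL : `|F| <= scalar_of_real k (scalar_re (F y) + d / 2).
  apply: dual_norm_le_re => t t1; have := var t t1.
  have -> : \sum_(f <- s) scalar_re (scalar_conj (v f) * (f t - f y)) *+ 2 =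
      (scalar_re (F y) - scalar_re (F t)) *+ 2.
    rewrite !FE opprK addrC -sumrB -sumrMnl; apply: eq_bigr => f _.
    by rewrite mulrBr scalar_reD scalar_reN.
  lra.
have : scalar_re (x'' F) <= scalar_re (F y) + d / 2.
  apply: le_trans (scalar_re_le_abs _) _.
  rewrite -(scalar_of_real_le (k := k)) scalar_absK.
  apply: le_trans (dual_norm_ub x'' F) _; apply: le_trans FL.
  by rewrite ler_piMl ?dual_norm_ge0.
have -> : scalar_re (x'' F) = scalar_re (F y) + q y.
  suff <- : scalar_re (x'' F) - scalar_re (F y) = q y by rewrite addrC subrK.
  rewrite xFE FE opprK addrC -sumrB; apply: eq_bigr => f _.
  by rewrite scalar_abs_sqr mulrBr scalar_reD scalar_reN.
by have := dq y y1; lra.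
Qed.

Lemma weak_continuous (f : dual X) :
  continuous (fun x : weak_space X => f x : K^o).
Proof.
move=> x; apply: (@continuous_comp _ _ _
  (fun y : weak_space X => (fun f => f y) : {ptws dual X -> K^o})
  (fun g : {ptws dual X -> K^o} => g f)).
  exact: initial_continuous.
exact: (@proj_continuous _ (fun=> K^o) f).
Qed.

End dual_lemmas.

(** * The bidual map of a weakly compact operator *)

Section dual_map.
Context {R : realType} {k : scalars}.
Local Notation K := (scalar_field R k).
Context {X Y : normedModType K} (T : {linear X -> Y}) (cT : continuous T).

Let dual_map_in (f : dual Y) : (fun x => f (T x)) \in @continuous_functional R k X.
Proof.
rewrite inE; split; first by move=> a x y; rewrite !linearP.
by move=> x; apply: continuous_comp; [exact: cT|exact: dual_continuous].
Qed.

Definition dual_map (f : dual Y) : dual X := Dual (dual_map_in f).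

Lemma dual_mapE f x : dual_map f x = f (T x). Proof. by []. Qed.

(** By [bidual_approx] the images T x, with x in the unit ball and f (T x)
    close to x''(f o T) for finitely many f, form a filter base; the point
    sought is a weak cluster point of it in the compact closure of the image
    of the ball. *)
Lemma weakly_compact_bidual_ball (x'' : dual (dual X)) :
  weakly_compact T -> `|x''| <= 1 ->
  exists y, forall f, x'' (dual_map f) = f y.
Proof.
rewrite /weakly_compact precompactE => Tc x1.
pose D := [set se : seq (dual Y) * R | 0 < se.2].
pose B (se : seq (dual Y) * R) : set (weak_space Y) := T @` [set x | `|x| <= 1 /\
  forall f, f \in se.1 -> scalar_abs (f (T x) - x'' (dual_map f)) < se.2].
have FF : ProperFilter (filter_from D B).
  apply: filter_from_proper; last first.
    move=> [s e] /= e0.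
    have [x xle sx] := bidual_approx (map dual_map s) x1 e0.
    by exists (T x), x => //; split=> // f fs; exact: sx (map_f dual_map fs).
  apply: filter_from_filter; first by exists ([::], 1); rewrite /D/=.
  move=> [s1 e1] [s2 e2] /= e10 e20.
  exists (s1 ++ s2, Num.min e1 e2); first by rewrite /D /= lt_min e10.
  move=> _ [x [/= xle sx] <-]; split; exists x => //; split=> // f fs;
    have := sx f; rewrite mem_cat fs ?orbT lt_min => /(_ isT)/andP[]//.
have FT : filter_from D B (closure (T @` [set x | `|x| <= 1] : set (weak_space Y))).
  exists ([::], 1); first by rewrite /D/=.
  by apply: subset_trans (@subset_closure _ _) => _ [x [xle _] <-]; exists x.
have [y [_ Fy]] := Tc _ FF FT.
exists y => f; apply/eqP; rewrite -subr_eq0 -normr_le0 -scalar_absK.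
rewrite -(scalar_of_real0 (R := R)) scalar_of_real_le.
apply/ler_addgt0Pr => e e0; rewrite add0r.
have e20 : 0 < e / 2 by rewrite divr_gt0.
have Fe : filter_from D B (B ([:: f], e / 2)) by exists ([:: f], e / 2).
have ne : nbhs (y : weak_space Y)
    [set y' : weak_space Y | `|f y - f y'| < scalar_of_real k (e / 2)].
  have /cvgr_dist_lt := @weak_continuous _ _ Y f y; apply.
  rewrite lt_neqAle -(scalar_of_real0 (R := R)) scalar_of_real_le ltW// andbT.
  rewrite eq_le !scalar_of_real_le.
  by rewrite (ltW e20) /= -ltNge.
have [_ [[x [_ /(_ f)]]] /= + <-] := Fy _ _ Fe ne.
rewrite mem_head => /(_ isT) h1; rewrite -scalar_absK => h2.
have {}h2 : scalar_abs (f y - f (T x)) < e / 2.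
  by rewrite ltNge -(scalar_of_real_le (k := k));
    apply/negP => /(lt_le_trans h2); rewrite ltxx.
have -> : x'' (dual_map f) - f y =
   - (f (T x) - x'' (dual_map f)) - (f y - f (T x)) by ring.
rewrite (le_trans (scalar_absD _ _))// !scalar_absN.
lra.
Qed.

(** Gantmacher's theorem: T'' x'' lies in the canonical image of Y. *)
Lemma weakly_compact_bidual (x'' : dual (dual X)) :
  weakly_compact T -> exists y, forall f, x'' (dual_map f) = f y.
Proof.
move=> Tc.
have [->|x0] := eqVneq x'' 0.
  by exists 0 => f; rewrite linear0.
have [|y yE] := @weakly_compact_bidual_ball (`|x''|^-1 *: x'') Tc.
  by rewrite normrZ normfV normr_id mulVf// normr_eq0.
exists (`|x''| *: y) => f; rewrite linearZ/= -yE dual_scaleE scalerA.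
by rewrite divff ?normr_eq0// scale1r.
Qed.

End dual_map.

(** * Arens regularity *)

(** With b in E representing T'' x'', both extensions apply y'' to the
    functional y |-> z'(n(b, y)). *)
Lemma arens_regular_comp_weakly_compact (R : realType) (k : scalars)
    (X Y Z E : normedModType (scalar_field R k)) (m : bounded_bilinear X Y Z)
    (n : bounded_bilinear E Y Z) (T : {linear X -> E}) :
  continuous T -> weakly_compact T -> (forall x y, m x y = n (T x) y) ->
  arens_regular m.
Proof.
move=> cT Tc mE x'' y''; apply: dual_ext => z'.
have [b bE] := weakly_compact_bidual cT x'' Tc.
transitivity (y'' (adjoint n z' b)).
  transitivity (adjoint (adjoint n) y'' z' b); last by [].
  rewrite -bE; congr (x'' _); apply: dual_ext => x.
  rewrite dual_mapE !adjointE; congr (y'' _); apply: dual_ext => y.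
  by rewrite !adjointE mE.
congr (y'' _); apply: dual_ext => y.
transitivity (adjoint (transpose n) z' y b); first by [].
rewrite -bE; congr (x'' _); apply: dual_ext => x.
by rewrite dual_mapE !adjointE /= mE.
Qed.

Section bmul_map.
Context {R : realType} {k : scalars}.
Local Notation K := (scalar_field R k).
Context {A B : banachAlgType K} (T : {linear A -> B}) (cT : continuous T).

Let bmul_map_bilinear :
  bilinear_for *:%R *:%R (fun (b : B) (a : A) => bmul b (T a)).
Proof.
split=> [a|b] c u v; first by rewrite /= bmul_bilinear.1.
by rewrite linearP bmul_bilinear.2.
Qed.

Let bmul_map_bounded :
  exists M : K, forall (b : B) (a : A), `|bmul b (T a)| <= M * `|b| * `|a|.
Proof.
have /linear_boundedP/pinfty_ex_gt0[M M0 TM] : bounded_near T (nbhs (0 : A)).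
  by apply: continuous_linear_bounded; exact: cT.
exists M => b a; apply: le_trans (bmul_norm _ _) _.
by rewrite [M * _]mulrC -mulrA ler_wpM2l.
Qed.

Definition bmul_map : bounded_bilinear B A B :=
  mk_bounded_bilinear bmul_map_bilinear bmul_map_bounded.

End bmul_map.

Unset Implicit Arguments.
Theorem mainTheorem3 (R : realType) (k : scalars)
    (A B : banachAlgType (scalar_field R k)) (M : banach_bimodule A B)
    (T : {linear A -> B}) (T_continuous : continuous T)
    (T_mul : forall a1 a2 : A, T (bmul a1 a2) = bmul (T a1) (T a2))
    (T_weakly_compact : weakly_compact T) :
  arens_regular (hom_mul T_continuous).
Proof.
apply: (arens_regular_comp_weakly_compact (n := bmul_map T_continuous)
  T_continuous T_weakly_compact).
exact: T_mul.
Qed.
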